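(* Let $q$ be a power of an odd prime and let $n\geqslant 3$ be odd. Then $$\omega(\tau PSL_n(q))=\omega(\tau PGL_n(q))=2\cdot\omega(Sp_{n-1}(q)).$$
   Context: For a group or a coset $X$ in a group, $\omega(X)$ is the set of orders of elements of $X$; $2\cdot A=\{2a\mid a\in A\}$. $\tau$ is the automorphism of $PGL_n(q)$ (and $PSL_n(q)$) induced by the inverse-transpose map $g\mapsto g^{-\top}$ of $GL_n(q)$; the cosets $\tau PSL_n(q)\subseteq\tau PGL_n(q)$ are taken in $PGL_n(q)\rtimes\langle\tau\rangle$. *)

(* Defs.v *)
From HB Require Import structures.
From mathcomp Require Import all_boot all_order all_algebra.
From mathcomp Require Import all_fingroup all_solvable.
From mathcomp Require Import finmap.

Set Implicit Arguments.
Unset Strict Implicit.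
Unset Printing Implicit Defensive.

Import GRing.Theory.
Local Open Scope group_scope.

Definition omega (gT : finGroupType) (X : {set gT}) : {fset nat} :=
  [fset #[x] | x in X]%fset.

(* For n = 0 the type {'GL_n[F]} consists of 1 x 1 matrices, so all the groups
   below are only meaningful for n > 0. *)
Section LinearGroups.

Variables (n : nat) (F : finFieldType).

Definition SL : {set {'GL_n[F]}} := [set g : {'GL_n[F]} | (\det g == 1)%R].

Definition PGL : {group coset_of 'Z('GL_n[F])} :=
  ('GL_n[F] / 'Z('GL_n[F]))%G.

(* The image of SL in PGL; it is isomorphic to SL / (SL :&: 'Z('GL_n[F])). *)
Definition PSL : {set coset_of 'Z('GL_n[F])} := SL / 'Z('GL_n[F]).

(* Gram matrix of the standard alternating form, with block form
   (0, 1; -1, 0) when n is even; for odd n it is degenerate. *)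
Definition Sp_form : 'M[F]_(n.-1.+1) :=
  (\matrix_(i, j) ((j == i + n./2 :> nat)%N%:R - (i == j + n./2 :> nat)%N%:R))%R.

(* Meaningful for n even. *)
Definition Sp : {set {'GL_n[F]}} :=
  [set g : {'GL_n[F]} | (g^T *m Sp_form *m g)%R == Sp_form].

Lemma Sp_group_set : group_set Sp.
Proof.
apply/group_setP; split=> [|g h].
  by rewrite inE GL_1E trmx1 mul1mx mulmx1.
rewrite !inE GL_MxE trmx_mul.
move: (GLval g) (GLval h) => A B /eqP HA /eqP HB.
have -> : (B^T *m A^T *m Sp_form *m (A *m B) =
           B^T *m (A^T *m Sp_form *m A) *m B)%R by rewrite !mulmxA.
by rewrite HA HB.
Qed.
Canonical Sp_group := Group Sp_group_set.

Lemma invtr_proof (g : {'GL_n[F]}) : (invmx (GLval g))^T%R \is a GRing.unit.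
Proof.
change ((invmx (GLval g))^T%R \in unitmx).
by rewrite unitmx_tr unitmx_inv; exact: GL_unit.
Qed.

Definition invtr (g : {'GL_n[F]}) : {'GL_n[F]} :=
  FinRing.unit _ (invtr_proof g).

Lemma invtrM : {morph invtr : g h / g * h}.
Proof.
move=> g h; apply: val_inj.
change ((invmx (GLval (g * h)))^T = (invmx (GLval g))^T *m (invmx (GLval h))^T)%R.
by rewrite -GL_VxE invMg GL_MxE trmx_mul !GL_VxE.
Qed.

Lemma invtrK : involutive invtr.
Proof.
move=> g; apply: val_inj.
change ((invmx (invmx (GLval g))^T)^T = GLval g)%R.
by rewrite -trmx_inv trmxK invmxK.
Qed.

Lemma invtr_center g : g \in 'Z('GL_n[F]) -> invtr g \in 'Z('GL_n[F]).
Proof.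
case/centerP=> _ cg; apply/centerP; split=> [|h _]; first by rewrite inE.
by rewrite -[h]invtrK /commute -!invtrM cg ?inE.
Qed.

Lemma invtr_coset g h : coset 'Z('GL_n[F]) g = coset 'Z('GL_n[F]) h ->
  coset 'Z('GL_n[F]) (invtr g) = coset 'Z('GL_n[F]) (invtr h).
Proof.
have nZ x : x \in 'N('Z('GL_n[F])).
  by apply: (subsetP (normal_norm (center_normal _))); rewrite inE.
move/(rcoset_kercosetP (nZ _) (nZ _))/rcosetP=> [z Zz ->].
by rewrite invtrM morphM ?nZ //= (coset_id (invtr_center Zz)) mul1g.
Qed.

Definition tau_fun (x : coset_of 'Z('GL_n[F])) : coset_of 'Z('GL_n[F]) :=
  coset 'Z('GL_n[F]) (invtr (repr x)).

Lemma tau_funE g :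
  tau_fun (coset 'Z('GL_n[F]) g) = coset 'Z('GL_n[F]) (invtr g).
Proof. by apply: invtr_coset; rewrite coset_reprK. Qed.

Lemma tau_funM : {in PGL &, {morph tau_fun : x y / x * y}}.
Proof.
move=> _ _ /morphimP[g Ng _ ->] /morphimP[h Nh _ ->].
have nZ x : x \in 'N('Z('GL_n[F])).
  by apply: (subsetP (normal_norm (center_normal _))); rewrite inE.
by rewrite -morphM //= !tau_funE invtrM morphM.
Qed.
Canonical tau_morphism := Morphism tau_funM.

Lemma tau_funK : involutive tau_fun.
Proof.
by move=> x; rewrite -[x]coset_reprK !tau_funE invtrK.
Qed.

Lemma tau_injm : 'injm tau_fun.
Proof. by apply/injmP => x y _ _; apply: (can_inj tau_funK). Qed.

Lemma tau_im : tau_fun @* PGL = PGL.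
Proof.
apply/morphim_fixP; first exact: tau_injm.
  exact: subxx.
apply/subsetP=> _ /morphimP[x _ _ ->]; rewrite /tau_fun.
by apply: mem_quotient; rewrite inE.
Qed.

(* The automorphism of PGL induced by g |-> g^{-T}. *)
Definition tau : {perm coset_of 'Z('GL_n[F])} := aut tau_injm tau_im.

Lemma tauE g : tau (coset 'Z('GL_n[F]) g) = coset 'Z('GL_n[F]) (invtr g).
Proof.
rewrite /tau autE; first exact: tau_funE.
by apply: mem_quotient; rewrite inE.
Qed.

Lemma tau_Aut : <[tau]> \subset Aut PGL.
Proof. by rewrite cycle_subG Aut_aut. Qed.

Definition tau_act : groupAction <[tau]> PGL := ([Aut PGL] \ tau_Aut)%gact.

(* The coset tau X in the semidirect product of PGL by <[tau]>. *)
Definition tau_coset (X : {set coset_of 'Z('GL_n[F])}) :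
    {set sdprod_by tau_act} :=
  sdpair2 tau_act tau *: (sdpair1 tau_act @* X).

End LinearGroups.

(* Main.v *)
Require Import Defs.
From HB Require Import structures.
From mathcomp Require Import all_boot all_order all_algebra.
From mathcomp Require Import all_fingroup all_solvable.
From mathcomp Require Import finmap.

Import GRing.Theory.

(* For g in GL_n the square of tau g is the cosquare c = g^{-T} g of the
   bilinear form g.  As n is odd, g - g^T is singular, so c has eigenvalue 1;
   hence c has the same order modulo scalars as in GL_n, and tau g has order
   2 |c|.  Rescaling g and changing the basis makes det g = 1 without changing
   |c|, which gives the first equality.

   For the second one, split an isometry of a form g, or of an alternating form
   A, into a unipotent part and a part without eigenvalue 1.  On the latter,
   A = g - g^T turns cosquares of g into isometries of A, and conversely
   g = (c - 1)^-1 A.  On the former the dimensions are 2m + 1 for g and 2m for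
   A, and in both cases the orders of the unipotent elements are exactly the
   powers of p up to the least one that is >= 2m + 1, since p is odd; the
   maximal order is attained by the Cayley transform of a nilpotent Jordan block
   that is skew-adjoint for an antidiagonal form.

   Forms are written in the row convention: c preserves B when c B c^T = B, and
   c is the (transposed) cosquare of g when c g = g^T. *)

(** * Orders in rings *)

Section Powers.
Local Open Scope ring_scope.

(** Orders are kept as a divisibility criterion on exponents, which makes sense for matrices of any
    size, including 0, without packing them as group elements. Here [t] is the least positive
    exponent sending [x] to 1. *)
Lemma expr_order (R : pzRingType) (x : R) (N : nat) :
    (0 < N)%N -> x ^+ N = 1 ->
  exists2 t, (t %| N)%N & forall k, (x ^+ k == 1) = (t %| k)%N.
Proof.
move=> N0 xN.
have exP : exists m, (0 < m)%N && (x ^+ m == 1) by exists N; rewrite N0 xN eqxx.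
case: (ex_minnP exP) => t /andP[t0 /eqP xt] tmin.
have tE k : (x ^+ k == 1) = (t %| k)%N.
  apply/idP/idP => [|/dvdnP[j ->]]; last by rewrite mulnC exprM xt expr1n.
  rewrite {1}(divn_eq k t) mulnC exprD exprM xt expr1n mul1r => xr.
  rewrite /dvdn -leqn0 leqNgt; apply/negP => r0.
  by have := tmin _ (introT andP (conj r0 xr)); rewrite leqNgt ltn_pmod.
by exists t => //; rewrite -tE xN.
Qed.

Lemma expr_order_pprod (R : pzRingType) (x : R) (p b : nat) :
    prime p -> x ^+ (p ^ b)%N = 1 ->
  exists2 a, (a <= b)%N & forall k, (x ^+ k == 1) = (p ^ a %| k)%N.
Proof.
move=> p_pr xpb; have pb0 : (0 < p ^ b)%N by rewrite expn_gt0 prime_gt0.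
have [t] := expr_order _ x _ pb0 xpb.
by case/(dvdn_pfactor _ _ p_pr) => a ab -> kE; exists a.
Qed.

(* A p-element of maximal order p ^ b has powers of every order p ^ a, and the
   exponent p ^ (b - a) is odd. *)
Lemma expr_order_power (R : pzRingType) (x : R) (p a b : nat) :
    prime p -> (a <= b)%N -> x ^+ (p ^ b)%N = 1 ->
    b = 0%N \/ x ^+ (p ^ b.-1)%N <> 1 ->
  forall k, ((x ^+ (p ^ (b - a))%N) ^+ k == 1) = (p ^ a %| k)%N.
Proof.
move=> p_pr ab xpb xpb1 k.
have [b' b'b xE] := expr_order_pprod _ _ _ _ p_pr xpb.
have bb' : b = b'.
  case: xpb1 => [b0|/eqP]; first by apply/eqP; rewrite eqn_leq b'b b0.
  rewrite xE dvdn_Pexp2l ?prime_gt1 // => nb'.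
  apply/eqP; rewrite eqn_leq b'b andbT.
  by case: (b) nb' => // b1; rewrite -ltnNge.
rewrite -exprM xE -bb' -{1}(subnK ab) expnD dvdn_pmul2l //.
by rewrite expn_gt0 prime_gt0.
Qed.

(** Pigeonhole: two powers of [x] agree, so the powers are periodic from some index on. An exponent
    beyond that index which is a multiple of the period gives an idempotent. *)
Lemma expr_idempotent (F : finFieldType) (n : nat) (x : 'M[F]_n) :
  exists2 M, (0 < M)%N & x ^+ M *m x ^+ M = x ^+ M.
Proof.
pose T := 'M[F]_n; pose f (i : 'I_#|T|.+1) : T := x ^+ i.
have /injectivePn[i [j ij fij]] : ~~ injectiveb f.
  apply/injectiveP => /leq_card; rewrite card_ord => /leP; apply/leP.
  by rewrite -ltnNge.
wlog lt_ij : i j ij fij / (i < j)%N.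
  move=> H; case: (ltngtP i j) => [lt|lt|/ord_inj eq].
  - exact: (H i j).
  - by apply: (H j i) => //; rewrite eq_sym.
  - by rewrite eq eqxx in ij.
have per m t : (i <= m)%N -> x ^+ (m + t * (j - i)) = x ^+ m.
  move=> im; elim: t => [|t IH]; first by rewrite addn0.
  rewrite -{1}(subnK im) mulSn -addnA (addnA i) subnKC ?(ltnW lt_ij) //.
  by rewrite exprD exprD -[x ^+ j]fij -exprD -exprD addnA subnK.
have d0 : (0 < j - i)%N by rewrite subn_gt0.
exists (j * (j - i))%N.
  by rewrite muln_gt0 d0 (leq_trans _ lt_ij).
rewrite -[LHS]/(x ^+ _ * x ^+ _) -exprD per //.
by rewrite (leq_trans (ltnW lt_ij)) ?leq_pmulr.
Qed.

End Powers.

(** * Powers of unipotent, nilpotent and block diagonal matrices *)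

Section Matrices.
Local Open Scope ring_scope.
Local Set Implicit Arguments.
Local Unset Strict Implicit.
Variable F : finFieldType.

(** As 1 and [x] commute, this is the Frobenius identity for [1 + 'X] in [{poly F}], evaluated at
    [x]. *)
Lemma expr_addmx1_pchar (n p e : nat) (x : 'M[F]_n) :
  p \in [pchar F] -> (1 + x) ^+ (p ^ e)%N = 1 + x ^+ (p ^ e)%N.
Proof.
case: n x => [|n] x pF; first by rewrite [LHS]flatmx0 [RHS]flatmx0.
have pP : p \in [pchar {poly F}] by rewrite pchar_poly.
have pe : [pchar {poly F}].-nat (p ^ e)%N.
  by rewrite pnatX pnatE ?(pcharf_prime pF) // pP.
have := congr1 (horner_mx x) (exprDn_pchar 1 'X pe).
by rewrite expr1n rmorphD !rmorphXn rmorphD rmorph1 /= horner_mx_X.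
Qed.

(** The minimal polynomial divides a power of ['X], so it is one itself up to a unit, and it divides
    the characteristic polynomial, of degree [n]. *)
Lemma nilpotent_expr_dim (n M : nat) (x : 'M[F]_n) : x ^+ M = 0 -> x ^+ n = 0.
Proof.
case: n x => [|n] x xM; first by rewrite [LHS]flatmx0 [RHS]flatmx0.
have : mxminpoly x %| ('X - 0%:P) ^+ M.
  by apply: mxminpoly_min; rewrite subr0 rmorphXn /= horner_mx_X.
case/dvdp_exp_XsubCP => k _; rewrite subr0 => Xk.
have /dvdp_leq : 'X ^+ k %| char_poly x.
  by rewrite -(eqp_dvdl _ Xk) mxminpoly_dvd_char.
rewrite monic_neq0 ?char_poly_monic // size_char_poly size_polyXn ltnS => kn.
have xk : x ^+ k = 0.
  have /mxminpoly_minP : mxminpoly x %| 'X ^+ k by rewrite (eqp_dvdl _ Xk).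
  by rewrite rmorphXn /= horner_mx_X.
by have := exprD x (n.+1 - k) k; rewrite subnK ?kn // xk mulr0.
Qed.

Lemma expr_block_diag m n (a : 'M[F]_m) (b : 'M[F]_n) k :
  (block_mx a 0 0 b) ^+ k = block_mx (a ^+ k) 0 0 (b ^+ k).
Proof.
elim: k => [|k IH]; first by rewrite !expr0 -[1]/1%:M scalar_mx_block.
rewrite !exprS IH -[LHS]/(_ *m _) mulmx_block.
by rewrite !(mulmx0, mul0mx, addr0, add0r).
Qed.

Lemma expr_block_diag_eq1 m n (a : 'M[F]_m) (b : 'M[F]_n) k :
  ((block_mx a 0 0 b) ^+ k == 1) = (a ^+ k == 1) && (b ^+ k == 1).
Proof.
rewrite expr_block_diag -[X in _ == X]/1%:M scalar_mx_block.
apply/eqP/andP => [/eq_block_mx[-> _ _ ->] //|[/eqP-> /eqP->] //].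
Qed.
End Matrices.

(** * Splitting off the unipotent part of an isometry *)

Section Fitting.
Local Open Scope ring_scope.
Local Set Implicit Arguments.
Local Unset Strict Implicit.
Variable F : finFieldType.

(** Indexed by the size and both matrices, so that case analysis replaces [n] by [d1 + d2]
    everywhere and no cast between equal dimensions arises. *)
Variant fitting_spec : forall n, 'M[F]_n -> 'M[F]_n -> Prop :=
  FittingSpec d1 d2 (Q : 'M[F]_(d1 + d2)) B1 B2 c1 c2 of
    Q \in unitmx & (c1 - 1) ^+ d1 = 0 & c2 - 1 \in unitmx :
  fitting_spec (Q *m block_mx B1 0 0 B2 *m Q^T)
               (Q *m block_mx c1 0 0 c2 *m invmx Q).

Lemma exprmx_conj n (P : 'M[F]_n) c1 c2 k :
  P *m c1 = c2 *m P -> P *m c1 ^+ k = c2 ^+ k *m P.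
Proof.
move=> Pc; elim: k => [|k IH]; first by rewrite !expr0 mulmx1 mul1mx.
rewrite [in LHS]exprSr [in RHS]exprSr -[_ * c1]/(_ *m _) -[_ * c2]/(_ *m _).
by rewrite mulmxA IH -mulmxA Pc mulmxA.
Qed.

Lemma fitting_spec_of_split d1 d2 M (B c : 'M[F]_(d1 + d2))
    (W1 : 'M_(d1, d1 + d2)) (W2 : 'M_(d2, d1 + d2)) c1 c2 :
    (0 < M)%N -> row_full (col_mx W1 W2) ->
    W1 *m c = c1 *m W1 -> W2 *m c = c2 *m W2 ->
    W1 *m (c - 1) ^+ M = 0 -> W2 *m (c - 1) ^+ M = W2 ->
    W1 *m B *m W2^T = 0 -> W2 *m B *m W1^T = 0 ->
  fitting_spec B c.
Proof.
move=> M0 Pfull Wc1 Wc2 WE1 WE2 B12 B21.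
set P := col_mx W1 W2 in Pfull *.
have Pu : P \in unitmx by rewrite -row_full_unit.
have Pc : P *m c = block_mx c1 0 0 c2 *m P.
  by rewrite mul_col_mx mul_block_col !mul0mx addr0 add0r Wc1 Wc2.
have PB : P *m B *m P^T = block_mx (W1 *m B *m W1^T) 0 0 (W2 *m B *m W2^T).
  by rewrite tr_col_mx mul_col_mx mul_col_row B12 B21.
have Pc1 : P *m (c - 1) = block_mx (c1 - 1) 0 0 (c2 - 1) *m P.
  rewrite mulmxBr Pc mulmx1 -[X in _ - X]mul1mx -mulmxBl.
  by rewrite scalar_mx_block opp_block_mx add_block_mx !subr0.
(* In the adapted basis [(c - 1) ^+ M] has diagonal blocks 0 and 1: the first makes [c1 - 1]
   nilpotent, the second makes [c2 - 1] invertible because [M > 0]. *)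
have /eq_block_mx[c1M _ _ c2M] :
    block_mx ((c1 - 1) ^+ M) 0 0 ((c2 - 1) ^+ M) = block_mx 0 0 0 1.
  rewrite -expr_block_diag; apply: (can_inj (mulmxK Pu)).
  rewrite -(exprmx_conj M Pc1) mul_col_mx mul_block_col WE1 WE2.
  by rewrite !mul0mx mul1mx !add0r.
have -> : B = invmx P *m block_mx (W1 *m B *m W1^T) 0 0 (W2 *m B *m W2^T) *m
                (invmx P)^T.
  rewrite -PB !mulmxA mulVmx // mul1mx -mulmxA -trmx_mul mulVmx // trmx1.
  by rewrite mulmx1.
have -> : c = invmx P *m block_mx c1 0 0 c2 *m invmx (invmx P).
  by rewrite invmxK -mulmxA -Pc mulmxA mulVmx // mul1mx.
constructor; first by rewrite unitmx_inv.
  exact: nilpotent_expr_dim c1M.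
case: M M0 c2M {c1M WE1 WE2} => // M _; rewrite exprS => /mulmx1_unit.
by case.
Qed.

Lemma trmx_exp n (A : 'M[F]_n) k : (A ^+ k)^T = A^T ^+ k.
Proof.
elim: k => [|k IH]; first by rewrite !expr0 trmx1.
by rewrite exprS exprSr -IH -[_ * _]/(_ *m _) trmx_mul.
Qed.

(** With [N = c - 1], invariance of [B] reads [N B (- c^T) = B N^T]. Iterating moves [N ^+ M] from
    the right argument, where it fixes [W2], to the left one, where it kills [W1]. *)
Lemma kernel_image_orthogonal n m1 m2 M (B c : 'M[F]_n)
    (W1 : 'M_(m1, n)) (W2 : 'M_(m2, n)) :
  c *m B *m c^T = B -> W1 *m (c - 1) ^+ M = 0 -> W2 *m (c - 1) ^+ M = W2 ->
  W1 *m B *m W2^T = 0.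
Proof.
move=> cB W1E W2E; set N := c - 1 in W1E W2E.
have NB : N *m B *m - c^T = B *m N^T.
  rewrite mulmxBl mul1mx mulmxBl !mulmxN cB opprK addrC.
  by rewrite linearB /= trmx1 mulmxBr mulmx1.
have NBk k : N ^+ k *m B *m (- c^T) ^+ k = B *m N^T ^+ k.
  elim: k => [|k IH]; first by rewrite !expr0 mul1mx.
  have NTc : N^T ^+ k *m - c^T = - c^T *m N^T ^+ k.
    apply/esym; apply: commrX; apply/commr_sym/commrN/commr_sym.
    by rewrite linearB /= trmx1; apply/commrB/commr1.
  rewrite [N ^+ _]exprS [(- c^T) ^+ _]exprSr [N^T ^+ _]exprS.
  rewrite -[_ * N ^+ k]/(_ *m _) -[_ * - c^T]/(_ *m _) -[N^T * _]/(_ *m _).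
  have -> : N *m N ^+ k *m B *m ((- c^T) ^+ k *m - c^T)
            = N *m (N ^+ k *m B *m (- c^T) ^+ k) *m - c^T by rewrite !mulmxA.
  by rewrite IH -2!mulmxA NTc !mulmxA NB.
by rewrite -W2E trmx_mul mulmxA trmx_exp -(mulmxA W1) -NBk !mulmxA W1E !mul0mx.
Qed.

Lemma row_base_stable m n (A : 'M[F]_(m, n)) (C : 'M_n) :
  (A *m C <= A)%MS -> exists C1, row_base A *m C = C1 *m row_base A.
Proof.
move=> AC; have : (row_base A *m C <= row_base A)%MS.
  by rewrite !eq_row_base (eqmxMr C (eq_row_base A)).
by case/submxP => C1 E; exists C1.
Qed.

(* Splitting of an isometry c of B into its unipotent part and a part without
   eigenvalue 1: a power of c - 1 is idempotent since 'M_n is finite, and its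
   kernel and image are orthogonal for B. *)
Lemma fitting n (B c : 'M[F]_n) : c *m B *m c^T = B -> fitting_spec B c.
Proof.
move=> cB.
have [M M0 EE] := @expr_idempotent F n (c - 1).
set E := _ ^+ M in EE.
have cE : c *m E = E *m c.
  by apply: commrX; apply: commrB; [|apply: commr1].
have [c1 Wc1] : exists c1, row_base (kermx E) *m c = c1 *m row_base (kermx E).
  apply: row_base_stable; apply/sub_kermxP.
  by rewrite -mulmxA cE mulmxA mulmx_ker mul0mx.
have [c2 Wc2] : exists c2, row_base E *m c = c2 *m row_base E.
  by apply: row_base_stable; rewrite -cE submxMl.
have W1E : row_base (kermx E) *m E = 0.
  by apply/sub_kermxP; rewrite eq_row_base.
have W2E : row_base E *m E = row_base E.
  have /submxP[D ->] : (row_base E <= E)%MS by rewrite eq_row_base.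
  by rewrite -mulmxA EE.
(* Split 1 as [(1 - E) + E]; the rows of [1 - E] lie in the kernel of the idempotent [E]. *)
have full : row_full (col_mx (row_base (kermx E)) (row_base E)).
  rewrite -sub1mx -addsmxE -[1%:M](subrK E).
  apply: addmx_sub_adds; rewrite eq_row_base //.
  by apply/sub_kermxP; rewrite mulmxBl mul1mx EE subrr.
have dimE : n = (\rank (kermx E) + \rank E)%N.
  by rewrite mxrank_ker subnK ?rank_leq_row.
move: (row_base (kermx E)) (row_base E) full Wc1 Wc2 W1E W2E.
rewrite /E; move: c1 c2 dimE.
move: (\rank (kermx _)) => d1; move: (\rank _) => d2 c1 c2 dimE.
clear EE cE; move: E => _; subst n => W1 W2 full Wc1 Wc2 W1E W2E.
apply: (fitting_spec_of_split M0 full Wc1 Wc2 W1E W2E).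
  exact: kernel_image_orthogonal cB W1E W2E.
(* The opposite orthogonality is the same fact for [B^T], which [c] preserves too. *)
apply: trmx_inj; rewrite !trmx_mul trmxK trmx0 mulmxA.
apply: kernel_image_orthogonal _ W1E W2E.
by rewrite -mulmxA -{1}(trmxK c) -!trmx_mul cB.
Qed.
End Fitting.

(** * Regular unipotent isometries *)

Section Regular.
Local Open Scope ring_scope.
Local Set Implicit Arguments.
Local Unset Strict Implicit.
Variable F : finFieldType.

Section Shift.
Variable D : nat.

(** The nilpotent Jordan block. The alternating signs of [antidiag_mx] make this block skew-adjoint
    for it; they also make the form symmetric for odd [D] and alternating for even positive [D]. *)
Definition shift_mx : 'M[F]_D := \matrix_(i, j) (j == i.+1 :> nat)%:R.
Definition antidiag_mx : 'M[F]_D :=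
  \matrix_(i, j) ((-1) ^+ i * (i + j.+1 == D)%N%:R).

Lemma expr_shift_mx k :
  shift_mx ^+ k = \matrix_(i, j) (j == i + k :> nat)%N%:R.
Proof.
elim: k => [|k IH].
  by apply/matrixP => i j; rewrite expr0 !mxE addn0 eq_sym.
rewrite exprSr IH; apply/matrixP => i j; rewrite -[_ * _]/(_ *m _) !mxE.
have [lt|ge] := ltnP (i + k) D.
  rewrite (bigD1 (Ordinal lt)) //= !mxE eqxx mul1r addnS big1 ?addr0 // => l ne.
  rewrite !mxE; case: eqP => [e|]; rewrite ?mul0r //.
  by case/eqP: ne; apply: val_inj.
rewrite big1 => [|l _]; last first.
  by rewrite !mxE ltn_eqF ?mul0r // (leq_trans (ltn_ord l)).
by rewrite ltn_eqF // addnS (leq_trans (ltn_ord j)) // leqW.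
Qed.

Lemma expr_shift_mx_eq0 k : (shift_mx ^+ k == 0) = (D <= k)%N.
Proof.
rewrite expr_shift_mx; apply/eqP/idP => [/matrixP X0|Dk].
  rewrite leqNgt; apply/negP => kD; have D0 : (0 < D)%N by case: (D) kD.
  have /eqP := X0 (Ordinal D0) (Ordinal kD).
  by rewrite !mxE /= add0n eqxx oner_eq0.
apply/matrixP => i j; rewrite !mxE ltn_eqF //.
by rewrite (leq_trans (ltn_ord j)) // (leq_trans Dk) ?leq_addl.
Qed.

Lemma antidiag_mxK : antidiag_mx *m antidiag_mx^T = 1.
Proof.
apply/matrixP => i j; rewrite !mxE (bigD1 (rev_ord i)) //= !mxE.
rewrite -subSn // subSS subnKC 1?ltnW // eqxx mulr1 big1 => [|l ne].
  rewrite addr0; have [->|ne] := eqVneq i j.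
    by rewrite subnKC 1?ltnW // eqxx mulr1 -expr2 sqrr_sign.
  rewrite (_ : (_ == _) = false) ?mulr0 //; apply/negP => /eqP e.
  case/eqP: ne; apply/val_inj/eqP; rewrite -(eqn_add2r (D - i)) /=.
  by rewrite e subnKC // ltnW.
rewrite !mxE (_ : (_ == D) = false) ?mulr0 ?mul0r //; apply/negP => /eqP e.
case/eqP: ne; apply/val_inj/eqP; rewrite -(eqn_add2l i.+1) /=.
by rewrite subnKC // addSn -addnS e.
Qed.

Lemma tr_antidiag_mx : antidiag_mx^T = (-1) ^+ D.-1 *: antidiag_mx.
Proof.
apply/matrixP => i j; rewrite !mxE addnS -addSn addnC.
case: eqP => [/(congr1 predn)|]; rewrite ?mulr0 // !mulr1 addnS /= => <-.
rewrite exprD; by rewrite mulrAC -expr2 sqrr_sign mul1r.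
Qed.

Lemma shift_antidiag_mx :
  shift_mx *m antidiag_mx = - (antidiag_mx *m shift_mx^T).
Proof.
apply/matrixP => i j; rewrite !mxE.
(* Both products live on [i + j.+2 == D]; moving down one row flips the sign. The case splits
   isolate the last row and the last column, where the shift runs out. *)
transitivity ((-1) ^+ i.+1 * (i + j.+2 == D)%N%:R : F).
  have [lt|ge] := ltnP i.+1 D.
    rewrite (bigD1 (Ordinal lt)) //= !mxE eqxx mul1r big1 => [|l ne].
      by rewrite addr0 addSnnS.
    rewrite !mxE; case: eqP => [e|]; rewrite ?mul0r //.
    by case/eqP: ne; apply: val_inj.
  rewrite gtn_eqF ?mulr0; last first.
    by rewrite (leq_ltn_trans ge) // !addnS !ltnS leq_addr.
  rewrite big1 // => l _.
  by rewrite !mxE ltn_eqF ?mul0r // (leq_trans (ltn_ord l)).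
rewrite exprS !mulN1r mulNr; congr (- _).
have [lt|ge] := ltnP j.+1 D.
  rewrite (bigD1 (Ordinal lt)) //= !mxE eqxx mulr1 big1 ?addr0 // => l ne.
  rewrite !mxE; case: (_ =P j.+1) => [e|]; rewrite ?mulr0 //.
  by case/eqP: ne; apply: val_inj.
rewrite gtn_eqF ?mulr0; last first.
  by rewrite (leq_ltn_trans ge) // !addnS !ltnS leq_addl.
rewrite big1 // => l _.
by rewrite !mxE (@ltn_eqF l) ?mulr0 // (leq_trans (ltn_ord l)).
Qed.

End Shift.

End Regular.

(** * Unipotent isometries and cosquares of prescribed order *)

Section Unip.
Local Open Scope ring_scope.
Local Set Implicit Arguments.
Local Unset Strict Implicit.
Variables (F : finFieldType) (p : nat).
Hypotheses (pF : p \in [pchar F]) (p_odd : odd p).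
Let p_pr : prime p := pcharf_prime pF.

Lemma two_neq0 : 2%:R != 0 :> F.
Proof.
rewrite -(dvdn_pcharf pF); apply: contraTN p_odd.
by rewrite dvdn_prime2 // => /eqP->.
Qed.

(** By Frobenius [1 + x] has [p ^ k]-th power 1, because [k <= p ^ k]. *)
Lemma addmx1_nilpotent_unit n k (x : 'M[F]_n) : x ^+ k = 0 -> 1 + x \in unitmx.
Proof.
move=> xk; have kp : (k <= p ^ k)%N by rewrite ltnW // ltn_expl // prime_gt1.
have : (1 + x) ^+ (p ^ k)%N = 1.
  by rewrite (expr_addmx1_pchar _ _ pF) -(subnK kp) exprD xk mulr0 addr0.
have : (0 < p ^ k)%N by rewrite expn_gt0 prime_gt0.
case: (p ^ k)%N => // m _; by rewrite exprS => /mulmx1_unit[].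
Qed.

(* u is the Cayley transform of a nilpotent Jordan block X which is
   skew-adjoint for the antidiagonal form J; note g = (1 - X) J and
   g^T = +-(1 + X) J. *)
Lemma regular_unipotent D :
  exists B g u : 'M[F]_D.+1,
  [/\ B \in unitmx, B^T = (-1) ^+ D *: B & u *m B *m u^T = B] /\
  [/\ g \in unitmx, ~~ odd D -> u *m g = g^T &
      forall e, (u ^+ (p ^ e)%N == 1) = (D < p ^ e)%N].
Proof.
pose X := shift_mx F D.+1; pose J := antidiag_mx F D.+1.
have Xnil : X ^+ D.+1 = 0 by apply/eqP; rewrite expr_shift_mx_eq0.
have Ju : J \in unitmx by have /mulmx1_unit[] := antidiag_mxK F D.+1.
have Y1u : 1 + X \in unitmx := addmx1_nilpotent_unit Xnil.
have Y2u : 1 - X \in unitmx.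
  by apply: (@addmx1_nilpotent_unit _ D.+1); rewrite exprNn Xnil mulr0.
have XJ : J *m X^T = - (X *m J) by rewrite shift_antidiag_mx opprK.
have Y1J : J *m (1 + X)^T = (1 - X) *m J.
  by rewrite linearD /= trmx1 mulmxDr mulmxBl mulmx1 mul1mx XJ.
have Y2J : J *m (1 - X)^T = (1 + X) *m J.
  by rewrite linearB /= trmx1 mulmxBr mulmxDl mulmx1 mul1mx XJ opprK.
have comY : (1 - X) *m (1 + X) = (1 + X) *m (1 - X).
  apply: commrD; first exact: commr1.
  by apply/commr_sym/commrB; [apply: commr1|].
pose u := (1 + X) *m invmx (1 - X).
have uY : u *m (1 - X) = 1 + X by rewrite -mulmxA mulVmx ?mulmx1.
have JT : J^T = (-1) ^+ D *: J := tr_antidiag_mx F D.+1.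
(* Transporting [J] by [1 - X] avoids inverses: [B] and [u B u^T = (1 + X) J (1 + X)^T] both reduce
   to [(1 - X) (1 + X) J]. *)
exists ((1 - X) *m J *m (1 - X)^T), ((1 - X) *m J), u; split; split.
- by rewrite !unitmx_mul unitmx_tr Y2u Ju.
- by rewrite !trmx_mul trmxK JT -scalemxAl -scalemxAr mulmxA.
- rewrite -!mulmxA -trmx_mul uY Y1J Y2J !mulmxA uY.
  by rewrite comY.
- by rewrite unitmx_mul Y2u.
- move=> evD; rewrite mulmxA uY trmx_mul JT -signr_odd (negbTE evD).
  by rewrite scale1r Y2J.
move=> e; have pe_odd : odd (p ^ e)%N by rewrite oddX p_odd orbT.
have comu : GRing.comm u (1 - X).
  rewrite /GRing.comm -[LHS]/(_ *m _) uY -[RHS]/(_ *m _) mulmxA comY.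
  by rewrite -mulmxA mulmxV // mulmx1.
(* Frobenius applied to [u (1 - X) = 1 + X]; the sign survives since [p ^ e] is odd. Hence
   [u ^+ (p ^ e) = 1] exactly when twice [X ^+ (p ^ e)] vanishes. *)
have uYe : u ^+ (p ^ e)%N *m (1 - X ^+ (p ^ e)%N) = 1 + X ^+ (p ^ e)%N.
  rewrite -(expr_addmx1_pchar _ _ pF) -uY -[u *m _]/(u * _) exprMn_comm //.
  rewrite (expr_addmx1_pchar _ (- X) pF) exprNn -signr_odd pe_odd.
  by rewrite expr1 mulN1r.
rewrite -(expr_shift_mx_eq0 F D.+1) -/X; apply/eqP/eqP => [u1|Xe].
  move: uYe; rewrite u1 mul1mx => /(congr1 (fun z => z - 1 + X ^+ (p ^ e)%N)).
  rewrite addrAC subrK subrr (addrAC 1) subrr add0r -mulr2n -scaler_nat.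
  move=> /esym/eqP; rewrite scaler_eq0 (negbTE two_neq0) => /eqP //.
by move: uYe; rewrite Xe subr0 addr0 mulmx1.
Qed.

(** The hypotheses make [p ^ b] the least power of [p] that is at least [D], which is the order of
    the regular unipotent isometry; a suitable power of it has order [p ^ a] and preserves the same
    form. *)
Lemma unipotent_alternating D b a :
    ~~ odd D -> (D <= p ^ b)%N -> b = 0%N \/ (p ^ b.-1 < D)%N -> (a <= b)%N ->
  exists B u : 'M[F]_D, [/\ B \in unitmx, B^T = - B, u *m B *m u^T = B &
    forall k, (u ^+ k == 1) = (p ^ a %| k)%N].
Proof.
case: D => [|D] evD Dpb pbD ab.
  case: pbD => [b0|]; last by rewrite ltn0.
  move: ab; rewrite b0 leqn0 => /eqP->; exists 1%:M, 1%:M.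
  split=> [|||k]; try by rewrite [LHS]flatmx0 [RHS]flatmx0.
    exact: unitmx1.
  by rewrite dvd1n; apply/eqP; rewrite [LHS]flatmx0 [RHS]flatmx0.
have [B [_ [u [[Bu BT uB] [_ _ uE]]]]] := regular_unipotent D.
exists B, (u ^+ (p ^ (b - a))%N); split=> //.
- by rewrite BT -signr_odd (negbNE evD : odd D) expr1 scaleN1r.
- elim: (p ^ _)%N => [|m IH]; first by rewrite expr0 mul1mx trmx1 mulmx1.
  by rewrite exprSr trmx_mul !mulmxA -(mulmxA _ u) -(mulmxA _ (u *m B)) uB.
apply: expr_order_power => //; first by apply/eqP; rewrite uE.
by case: pbD => [|lt]; [left|right; apply/eqP; rewrite uE -leqNgt].
Qed.

(** For [m = 2r + 1] take [h = g (c^r)^T]. Since [c] is an isometry of [g],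
    [c^m h = c^(r+1) g = c^r g^T = h^T]. *)
Lemma cosquare_odd_power n (g c : 'M[F]_n) m :
    g \in unitmx -> c *m g = g^T -> odd m ->
  exists2 h, h \in unitmx & c ^+ m *m h = h^T.
Proof.
move=> gu cg; have cgc : c *m g *m c^T = g.
  by rewrite cg -trmx_mul cg trmxK.
have cu : c \in unitmx.
  have : c *m g \in unitmx by rewrite cg unitmx_tr.
  by rewrite unitmx_mul => /andP[].
have cku k : c ^+ k \in unitmx.
  elim: k => [|k IH]; first by rewrite expr0 unitmx1.
  by rewrite exprS unitmx_mul cu.
have cgck k : c ^+ k *m g *m (c ^+ k)^T = g.
  elim: k => [|k IH]; first by rewrite expr0 mul1mx trmx1 mulmx1.
  rewrite exprSr trmx_mul !mulmxA -(mulmxA _ c) -(mulmxA _ (c *m g)) cgc.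
  exact: IH.
move=> m_odd; exists (g *m (c ^+ m./2)^T).
  by rewrite unitmx_mul gu unitmx_tr cku.
rewrite trmx_mul trmxK -cg -{1}(odd_double_half m) m_odd -addnn add1n.
rewrite exprS exprD.
rewrite -[_ * _]/(_ *m (_ *m _)) -!mulmxA (mulmxA (c ^+ _) g) cgck !mulmxA.
by congr (_ *m _); apply: commrX.
Qed.

Lemma unipotent_cosquare D b a :
    odd D -> (D <= p ^ b)%N -> b = 0%N \/ (p ^ b.-1 < D)%N -> (a <= b)%N ->
  exists g c : 'M[F]_D, [/\ g \in unitmx, c *m g = g^T &
    forall k, (c ^+ k == 1) = (p ^ a %| k)%N].
Proof.
case: D => [|D] //= evD Dpb pbD ab.
have [_ [g [u [_ [gu ug uE]]]]] := regular_unipotent D.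
have od : odd (p ^ (b - a))%N by rewrite oddX p_odd orbT.
have [h hu uh] := cosquare_odd_power gu (ug evD) od.
exists h, (u ^+ (p ^ (b - a))%N); split=> //.
apply: expr_order_power => //; first by apply/eqP; rewrite uE.
by case: pbD => [|lt]; [left|right; apply/eqP; rewrite uE -leqNgt].
Qed.
End Unip.

(** * Isometries of alternating forms versus cosquares *)

Section Corresp.
Local Open Scope ring_scope.
Local Set Implicit Arguments.
Local Unset Strict Implicit.
Variables (F : finFieldType) (p : nat).
Hypotheses (pF : p \in [pchar F]) (p_odd : odd p).
Let p_pr : prime p := pcharf_prime pF.

Lemma eq_opp_mx0 m n (A : 'M[F]_(m, n)) : A = - A -> A = 0.
Proof.
move/(congr1 (+%R A)); rewrite subrr -mulr2n -scaler_nat => /eqP.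
by rewrite scaler_eq0 (negbTE (two_neq0 pF p_odd)) => /eqP.
Qed.

Lemma alternating_odd_singular n (A : 'M[F]_n) :
  A^T = - A -> odd n -> A \notin unitmx.
Proof.
move=> AT n_odd; rewrite unitmxE unitfE negbK; apply/eqP.
have dA : \det A = - \det A.
  by rewrite -{1}det_tr AT -scaleN1r detZ -signr_odd n_odd expr1 mulN1r.
have /matrixP/(_ 0 0) : (\det A)%:M = 0 :> 'M[F]_1.
  by apply: eq_opp_mx0; rewrite -scalemx1 -scaleNr -dA.
by rewrite !mxE eqxx mulr1n.
Qed.

Lemma block_diag_unit m n (A : 'M[F]_m) (B : 'M[F]_n) :
  (block_mx A 0 0 B \in unitmx) = (A \in unitmx) && (B \in unitmx).
Proof. by rewrite !unitmxE det_ublock unitrM. Qed.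

Lemma congruence_unit n (Q B : 'M[F]_n) :
  Q \in unitmx -> (Q *m B *m Q^T \in unitmx) = (B \in unitmx).
Proof. by move=> Qu; rewrite !unitmx_mul unitmx_tr Qu andbT. Qed.

Lemma congruence_inj n (Q : 'M[F]_n) :
  Q \in unitmx -> injective (fun B => Q *m B *m Q^T).
Proof.
move=> Qu B C /(can_inj (mulmxK _)) E; apply: (can_inj (mulKmx Qu)).
by apply: E; rewrite unitmx_tr.
Qed.

Lemma conj_expr_eq1 n (Q c : 'M[F]_n) k :
  Q \in unitmx -> ((Q *m c *m invmx Q) ^+ k == 1) = (c ^+ k == 1).
Proof.
move=> Qu; have Qc : Q *m c = Q *m c *m invmx Q *m Q by rewrite mulmxKV.
have Qk := exprmx_conj k Qc; apply/eqP/eqP => [E|E].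
  by move: Qk; rewrite E mul1mx -[RHS]mulmx1 => /(can_inj (mulKmx Qu)).
by move: Qk; rewrite E mulmx1 -[LHS]mul1mx => /(can_inj (mulmxK Qu)).
Qed.

Lemma tr_block_diag m n (A : 'M[F]_m) (B : 'M[F]_n) :
  (block_mx A 0 0 B)^T = block_mx A^T 0 0 B^T.
Proof. by rewrite tr_block_mx !trmx0. Qed.

Lemma mul_block_diag m n (A A' : 'M[F]_m) (B B' : 'M[F]_n) :
  block_mx A 0 0 B *m block_mx A' 0 0 B' = block_mx (A *m A') 0 0 (B *m B').
Proof. by rewrite mulmx_block !(mulmx0, mul0mx, addr0, add0r). Qed.

Lemma opp_block_diag m n (A : 'M[F]_m) (B : 'M[F]_n) :
  - block_mx A 0 0 B = block_mx (- A) 0 0 (- B).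
Proof. by rewrite opp_block_mx !oppr0. Qed.

Lemma expr_unipotent d (x : 'M[F]_d) e :
  (x - 1) ^+ d = 0 -> (d <= p ^ e)%N -> x ^+ (p ^ e)%N = 1.
Proof.
move=> xd de; rewrite -{1}(subrK 1 x) addrC (expr_addmx1_pchar _ _ pF).
have -> : (x - 1) ^+ (p ^ e)%N = (x - 1) ^+ d * (x - 1) ^+ (p ^ e - d)%N.
  by rewrite -exprD subnKC.
by rewrite xd mul0r addr0.
Qed.

(* The same p ^ b works in dimensions 2m and 2m + 1 since p is odd. *)
Lemma up_log_odd_dim d (b := up_log p d.+1) :
  ~~ odd d -> (d < p ^ b)%N /\ (b = 0%N \/ (p ^ b.-1 < d)%N).
Proof.
move=> d_even; have p1 := prime_gt1 p_pr; split; first exact: up_logP.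
case: d d_even @b => [|d] d_even b; first by left; rewrite /b up_log1.
(* Minimality gives only a weak inequality; equality would make an even number a power of the odd
   prime [p]. *)
right; have := @up_log_bounds p d.+2 p1 isT; case/andP => lt _.
rewrite ltn_neqAle -ltnS lt andbT; apply: contraNneq d_even => <-.
by rewrite oddX p_odd orbT.
Qed.

Lemma isometry_of_cosquare n (g c : 'M[F]_n) :
    odd n -> g \in unitmx -> c *m g = g^T ->
  exists A s : 'M[F]_n.-1, [/\ A \in unitmx, A^T = - A, s *m A *m s^T = A &
    forall k, (s ^+ k == 1) = (c ^+ k == 1)].
Proof.
move=> + + cg; have cgc : c *m g *m c^T = g by rewrite cg -trmx_mul cg trmxK.
case: (fitting cgc) cg => d1 d2 Q g1 g2 c1 c2 Qu c1N c2u {n g c cgc} cg n_odd.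
rewrite congruence_unit // block_diag_unit => /andP[g1u g2u].
have /eq_block_mx[_ _ _ cg2] :
    block_mx (c1 *m g1) 0 0 (c2 *m g2) = block_mx g1^T 0 0 g2^T.
  apply: (congruence_inj Qu); rewrite -mul_block_diag -tr_block_diag.
  move: cg; rewrite !mulmxA mulmxKV // => ->.
  by rewrite !trmx_mul trmxK mulmxA.
pose A2 := g2 - g2^T.
have A2T : A2^T = - A2 by rewrite linearB /= trmxK opprB.
have A2u : A2 \in unitmx.
  have -> : A2 = - ((c2 - 1) *m g2) by rewrite mulmxBl mul1mx cg2 opprB.
  by rewrite -scaleN1r unitmxZ ?unitrN1 // unitmx_mul c2u.
have cA2 : c2 *m A2 *m c2^T = A2.
  have cg2c : c2 *m g2 *m c2^T = g2 by rewrite cg2 -trmx_mul cg2 trmxK.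
  rewrite mulmxBr mulmxBl cg2c; congr (_ - _).
  by rewrite -[in RHS]cg2c !trmx_mul trmxK mulmxA.
(* An invertible alternating form has even dimension, so the unipotent block has odd, hence
   positive, size. *)
have d2_even : ~~ odd d2.
  by apply: contraL A2u => /(alternating_odd_singular A2T).
move: n_odd; rewrite oddD (negbTE d2_even) addbF.
(* With [d1] now the predecessor, the target size is [d1 + d2]: the dimension lost is taken from the
   unipotent block. *)
case: d1 Q g1 c1 Qu c1N {g1u cg} => // d1 Q g1 c1 Qu c1N /= d1_even.
have [d1b bd1] := up_log_odd_dim d1_even; set b := up_log _ _ in d1b bd1.
have [a ab c1E] := expr_order_pprod _ _ _ _ p_pr (expr_unipotent c1N d1b).
have [A1 [u [A1u A1T uA1 uE]]] :=
  unipotent_alternating pF p_odd d1_even (ltnW d1b) bd1 ab.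
exists (block_mx A1 0 0 A2), (block_mx u 0 0 c2); split.
- by rewrite block_diag_unit A1u.
- by rewrite tr_block_diag A1T A2T opp_block_diag.
- by rewrite tr_block_diag !mul_block_diag uA1 cA2.
by move=> k; rewrite conj_expr_eq1 // !expr_block_diag_eq1 uE c1E.
Qed.

Lemma cosquare_of_isometry n (A s : 'M[F]_n) :
    A \in unitmx -> A^T = - A -> s *m A *m s^T = A ->
  exists g c : 'M[F]_n.+1, [/\ g \in unitmx, c *m g = g^T &
    forall k, (c ^+ k == 1) = (s ^+ k == 1)].
Proof.
move=> + + sA; case: (fitting sA) (sA).
move=> d1 d2 Q A1 A2 s1 s2 Qu s1N s2u {n A s sA} sA.
 rewrite congruence_unit // block_diag_unit => /andP[A1u A2u] AT.
have /eq_block_mx[A1T _ _ A2T] :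
    block_mx A1^T 0 0 A2^T = block_mx (- A1) 0 0 (- A2).
  apply: (congruence_inj Qu); rewrite -tr_block_diag -opp_block_diag.
  by move: AT; rewrite !trmx_mul trmxK mulmxA => ->; rewrite mulmxN mulNmx.
have /eq_block_mx[_ _ _ sA2] :
    block_mx (s1 *m A1 *m s1^T) 0 0 (s2 *m A2 *m s2^T) = block_mx A1 0 0 A2.
  apply: (congruence_inj Qu); rewrite -!mul_block_diag -tr_block_diag.
  move: sA; rewrite !trmx_mul !mulmxA mulmxKV // -(mulmxA _ Q^T) -trmx_mul.
  by rewrite mulVmx // trmx1 mulmx1.
have d1_even : ~~ odd d1.
  by apply: contraL A1u => /(alternating_odd_singular A1T).
have [d1b bd1] := up_log_odd_dim d1_even; set b := up_log _ _ in d1b bd1.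
have [a ab s1E] :=
  expr_order_pprod _ _ _ _ p_pr (expr_unipotent s1N (ltnW d1b)).
have bd1' : b = 0%N \/ (p ^ b.-1 < d1.+1)%N.
  by case: bd1 => [|/ltnW]; [left|right].
have [g1 [c1 [g1u cg1 c1E]]] :=
  unipotent_cosquare pF p_odd (d1_even : odd d1.+1) d1b bd1' ab.
have [g2 s2g2] : exists g2, (s2 - 1) *m g2 = A2.
  by exists (invmx (s2 - 1) *m A2); rewrite mulKVmx.
have g2u : g2 \in unitmx by move: A2u; rewrite -s2g2 unitmx_mul => /andP[].
have cg2 : s2 *m g2 = g2^T.
  have [N NE] : exists N, s2 = N + 1 by exists (s2 - 1); rewrite subrK.
  rewrite NE addrK in s2u s2g2.
  have A2g : A2 = - (g2^T *m N^T) by rewrite -trmx_mul s2g2 A2T opprK.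
  (* Since [N g2 = A2] and [g2^T N^T = - A2], this product is [A2 N^T + N A2 + N A2 N^T], which is 0
     because [N + 1] preserves [A2]. Cancelling [N] and [N^T] gives [g2^T = g2 + A2 = s2 g2]. *)
  have : N *m (g2 - g2^T + A2) *m N^T = 0.
    have gNT : g2^T *m N^T = - A2 by rewrite A2g opprK.
    have E1 : A2 + (A2 *m N^T + N *m A2 + N *m A2 *m N^T) = A2.
      have NT1 : (N + 1)^T = N^T + 1 by rewrite linearD /= trmx1.
      rewrite -[RHS]sA2 NE NT1 mulmxDl mul1mx mulmxDr !mulmx1.
      by rewrite mulmxDl [LHS]addrC [X in X + _ = _]addrC -!addrA.
    rewrite mulmxDr mulmxBr s2g2 mulmxDl mulmxBl -[N *m g2^T *m _]mulmxA gNT.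
    by rewrite mulmxN opprK; apply: (addrI A2); rewrite E1 addr0.
  have NTu : N^T \in unitmx by rewrite unitmx_tr.
  rewrite -[RHS](mul0mx _ N^T) => /(can_inj (mulmxK NTu)).
  rewrite -[RHS](mulmx0 _ N) => /(can_inj (mulKmx s2u)) => g2E.
  rewrite NE mulmxDl s2g2 mul1mx; apply/eqP; rewrite -subr_eq0 -g2E.
  by rewrite addrAC addrC (addrC A2) addrA.
have Gu : block_mx g1 0 0 g2 \in unitmx by rewrite block_diag_unit g1u.
have CG : block_mx c1 0 0 s2 *m block_mx g1 0 0 g2 = (block_mx g1 0 0 g2)^T.
  by rewrite tr_block_diag mul_block_diag cg1 cg2.
exists (block_mx g1 0 0 g2), (block_mx c1 0 0 s2); split=> // k.
rewrite conj_expr_eq1 // [RHS]expr_block_diag_eq1 s1E -c1E.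
by rewrite -expr_block_diag_eq1.
Qed.
End Corresp.

(** * Darboux bases *)

Section Darboux.
Local Open Scope ring_scope.
Local Set Implicit Arguments.
Local Unset Strict Implicit.
Variables (F : finFieldType) (p : nat).
Hypotheses (pF : p \in [pchar F]) (p_odd : odd p).

Let H : 'M[F]_(1 + 1) := block_mx 0 1%:M (- 1%:M) 0.

(** An orthogonal sum of hyperbolic planes. In odd size the recursion ends in a zero block of size
    1, so the form is degenerate there. *)
Fixpoint hyperbolic_mx n : 'M[F]_n :=
  if n is m.+2 then block_mx H 0 0 (hyperbolic_mx m) : 'M_(1 + 1 + m) else 0.

Variant hyperbolic_spec : forall n, 'M[F]_n -> Prop :=
  HyperbolicSpec m (P : 'M[F]_(1 + 1 + m)) A of P \in unitmx :
  hyperbolic_spec (P *m block_mx H 0 0 A *m P^T).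

Lemma alternating_isotropic n (A : 'M[F]_n) (e : 'rV_n) :
  A^T = - A -> e *m A *m e^T = 0.
Proof.
move=> AT; apply: (eq_opp_mx0 pF p_odd).
have tr1 (x : 'M[F]_1) : x^T = x by rewrite [x]mx11_scalar tr_scalar_mx.
by rewrite -[LHS]tr1 !trmx_mul trmxK AT mulNmx mulmxN mulmxA.
Qed.

(** A nonzero [e] and some [f] pairing to 1 with it span a hyperbolic plane [W]; a basis [V] of its
    orthogonal complement, the kernel of [A W^T], completes the new basis. *)
Lemma hyperbolic_split n (A : 'M[F]_n) :
  (0 < n)%N -> A \in unitmx -> A^T = - A -> hyperbolic_spec A.
Proof.
move=> n0 Au AT; pose e : 'rV[F]_n := delta_mx 0 (Ordinal n0).
have [f ef] : exists f, e *m A *m f = 1%:M.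
  apply/row_freeP; rewrite /row_free mxrankMfree ?row_free_unit //.
  by rewrite mxrank_delta.
pose W : 'M_(1 + 1, n) := col_mx e f^T.
have WAW : W *m A *m W^T = H.
  have fAe : f^T *m A *m e^T = - 1%:M.
    move/(congr1 trmx): ef; rewrite !trmx_mul AT mulNmx mulmxN trmx1 mulmxA.
    by move=> <-; rewrite opprK.
  have fAf : f^T *m A *m f = 0 by rewrite -{2}[f]trmxK alternating_isotropic.
  rewrite tr_col_mx mul_col_mx mul_col_row trmxK ef fAe fAf.
  by rewrite alternating_isotropic.
have Hu : H \in unitmx.
  have /mulmx1_unit[] // : H *m block_mx 0 (- 1%:M) 1%:M 0 = 1%:M.
  rewrite mulmx_block !(mulmx0, mul0mx, mul1mx, mulmxN, mulNmx, opprK).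
  by rewrite !(addr0, add0r) [RHS](@scalar_mx_block _ 1 1).
have rk : \rank (A *m W^T) = 2%N.
  apply/eqP; rewrite -[_ == _]/(row_full _).
  apply/row_fullP; exists (invmx H *m W).
  by rewrite -mulmxA [W *m _]mulmxA WAW mulVmx //.
have dimE : (1 + 1 + \rank (kermx (A *m W^T)) = n)%N.
  by rewrite mxrank_ker rk subnKC // -[X in (X <= _)%N]rk rank_leq_row.
have := row_base_free (kermx (A *m W^T)).
have : row_base (kermx (A *m W^T)) *m (A *m W^T) = 0.
  by apply/sub_kermxP; rewrite eq_row_base.
move: (row_base _); move: (\rank _) dimE => m dimE.
clearbody W; clear e ef rk; subst n => V VAW Vfree.
have VAW' : W *m A *m V^T = 0.
  apply: trmx_inj; rewrite !trmx_mul trmxK trmx0 AT mulNmx mulmxN.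
  by rewrite VAW oppr0.
pose P := col_mx W V.
have Pu : P \in unitmx.
  rewrite -row_free_unit; apply: inj_row_free => v.
  rewrite -[v]hsubmxK mul_row_col => vP.
  (* Pairing a linear relation with [W] removes its [V] part and leaves the [W] coefficients times
     the invertible [H]. *)
  have a0 : lsubmx v = 0.
    apply: (can_inj (mulmxK Hu)); rewrite mul0mx -WAW.
    move/(congr1 (mulmx^~ (A *m W^T))): vP.
    by rewrite mulmxDl -!mulmxA VAW mulmx0 addr0 mul0mx.
  move: vP; rewrite a0 mul0mx add0r -[RHS](mul0mx _ V).
  by move/(row_free_inj Vfree)->; rewrite row_mx0.
have -> : A = invmx P *m block_mx H 0 0 (V *m A *m V^T) *m (invmx P)^T.
  have <- : P *m A *m P^T = block_mx H 0 0 (V *m A *m V^T).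
    rewrite tr_col_mx mul_col_mx mul_col_row WAW VAW'.
    by rewrite -[V *m A *m W^T]mulmxA VAW.
  by rewrite !mulmxA mulVmx // mul1mx -mulmxA -trmx_mul mulVmx // trmx1 mulmx1.
by constructor; rewrite unitmx_inv.
Qed.

Lemma darboux n (A : 'M[F]_n) :
    A \in unitmx -> A^T = - A ->
  exists2 P, P \in unitmx & A = P *m hyperbolic_mx n *m P^T.
Proof.
have [k nk] := ubnP n; elim: k n nk A => // k IH n nk A Au AT.
have [n0|] := posnP n.
  by subst n; exists 1%:M; rewrite ?unitmx1 // [LHS]flatmx0 [RHS]flatmx0.
move=> n0; case: (hyperbolic_split n0 Au AT) (nk) (Au) (AT).
move=> m P A' Pu {n A n0 Au AT}nk.
rewrite congruence_unit // block_diag_unit => /andP[Hu Au'] AT.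
have /eq_block_mx[_ _ _ AT'] :
    block_mx H^T 0 0 A'^T = block_mx (- H) 0 0 (- A').
  apply: (congruence_inj Pu); rewrite -tr_block_diag -opp_block_diag.
  by move: AT; rewrite !trmx_mul trmxK mulmxA => ->; rewrite mulmxN mulNmx.
have [R Ru ->] := IH m (leq_trans (leqnSn _) nk) A' Au' AT'.
have RE : block_mx H 0 0 (R *m hyperbolic_mx m *m R^T) =
    block_mx 1%:M 0 0 R *m block_mx H 0 0 (hyperbolic_mx m) *m
    (block_mx 1%:M 0 0 R)^T.
  by rewrite tr_block_diag !mul_block_diag trmx1 mulmx1 mul1mx.
exists (P *m block_mx 1%:M 0 0 R).
  by rewrite unitmx_mul Pu block_diag_unit unitmx1.
by rewrite RE trmx_mul !mulmxA.
Qed.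

(** Both forms are congruent to [hyperbolic_mx n]. This carries an isometry of some alternating form
    to the fixed [Sp_form]. *)
Lemma alternating_congruent n (A B : 'M[F]_n) :
    A \in unitmx -> A^T = - A -> B \in unitmx -> B^T = - B ->
  exists2 P, P \in unitmx & P *m A *m P^T = B.
Proof.
move=> Au AT Bu BT; have [P Pu ->] := darboux Au AT.
have [R Ru ->] := darboux Bu BT.
exists (R *m invmx P); first by rewrite unitmx_mul Ru unitmx_inv.
rewrite trmx_mul -!mulmxA (mulmxA P^T) -trmx_mul mulVmx // trmx1 mul1mx.
by rewrite mulKmx.
Qed.
End Darboux.

(** * The general linear group *)

Lemma order_eq_dvd (gT : finGroupType) (x : gT) d :
  (forall k, (x ^+ k == 1)%g = (d %| k)) -> #[x]%g = d.
Proof.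
move=> xE; apply/eqP; rewrite eqn_dvd order_dvdn xE dvdnn.
by rewrite -xE expg_order eqxx.
Qed.

Section GL.
Local Open Scope ring_scope.
Local Set Implicit Arguments.
Local Unset Strict Implicit.
Variable F : finFieldType.

Lemma GL_of_unitmx m (A : 'M[F]_m.+1) :
  A \in unitmx -> exists g : {'GL_(m.+1)[F]}, GLval g = A.
Proof. by move=> Au; exists (FinRing.unit 'M[F]_m.+1 Au). Qed.

Lemma GL_expg m (g : {'GL_(m.+1)[F]}) k : GLval (g ^+ k)%g = GLval g ^+ k.
Proof. by elim: k => [|k IH]; rewrite ?expg0 ?expr0 // expgS exprS -IH. Qed.

Lemma GL_expg_eq1 m (g : {'GL_(m.+1)[F]}) k :
  (g ^+ k == 1)%g = (GLval g ^+ k == 1).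
Proof. by rewrite -GL_expg -val_eqE. Qed.

Lemma eq_GL_order m m' (g : {'GL_(m.+1)[F]}) (h : {'GL_(m'.+1)[F]}) :
    (forall k, (GLval g ^+ k == 1) = (GLval h ^+ k == 1)) -> #[g]%g = #[h]%g.
Proof.
move=> gh; apply: order_eq_dvd => k.
by rewrite GL_expg_eq1 gh order_dvdn GL_expg_eq1.
Qed.

Lemma invtrE m (g : {'GL_(m.+1)[F]}) : GLval (invtr g) = (invmx (GLval g))^T.
Proof. by []. Qed.

(** Links the group element [invtr g * g], which is the square of [tau g], to the row convention:
    its transpose is the [c] with [c g = g^T]. *)
Lemma cosquareE m (g : {'GL_(m.+1)[F]}) :
  (GLval (invtr g * g)%g)^T *m GLval g = (GLval g)^T.
Proof.
rewrite GL_MxE invtrE trmx_mul trmxK -mulmxA mulVmx ?mulmx1 //.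
exact: GL_unit.
Qed.

Variable p : nat.
Hypotheses (pF : p \in [pchar F]) (p_odd : odd p).

Lemma transvection_unit n (i j : 'I_n) :
  i != j -> (1 + delta_mx i j : 'M[F]_n) \in unitmx.
Proof.
move=> ij; apply: (@addmx1_nilpotent_unit F p pF _ 2).
rewrite expr2 -[_ * _]/(_ *m _) mul_delta_mx_cond eq_sym (negbTE ij).
by rewrite mulr0n.
Qed.

(** A central element commutes with every transvection, hence with every off-diagonal matrix unit;
    comparing entries leaves a scalar. *)
Lemma GL_center_scalar m (z : {'GL_(m.+1)[F]}) :
  z \in 'Z('GL_(m.+1)[F])%g -> exists a, GLval z = a%:M.
Proof.
case/centerP => _ zC; exists (GLval z 0 0).
have comd (i j : 'I_m.+1) : i != j ->
    GLval z *m delta_mx i j = delta_mx i j *m GLval z.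
  move=> ij; have [h hE] := GL_of_unitmx (transvection_unit ij).
  have /(congr1 GLval) := zC h (in_setT h).
  rewrite !GL_MxE hE mulmxDr mulmxDl mulmx1 mul1mx.
  by move/addrI.
have dE (i j k l : 'I_m.+1) :
    (GLval z *m delta_mx i j) k l = GLval z k i *+ (l == j).
  rewrite mxE (bigD1 i) //= mxE eqxx /= big1 ?addr0 => [|s ne].
    by rewrite mulr_natr.
  by rewrite mxE (negbTE ne) mulr0.
have dE' (i j k l : 'I_m.+1) :
    (delta_mx i j *m GLval z) k l = GLval z j l *+ (k == i).
  rewrite mxE (bigD1 j) //= mxE eqxx andbT big1 ?addr0 => [|s ne].
    by rewrite mulr_natl.
  by rewrite mxE (negbTE ne) andbF mul0r.
apply/matrixP => k i; rewrite mxE; have [->|ki] := eqVneq k i.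
  have [<-|i0] := eqVneq 0 i; first by rewrite mulr1n.
  have /matrixP/(_ 0 i) := comd _ _ i0.
  by rewrite dE dE' !eqxx !mulr1n.
have ik : i != k by rewrite eq_sym.
have /matrixP/(_ k k) := comd _ _ ik.
by rewrite dE dE' eqxx (negbTE ki) mulr1n mulr0n.
Qed.

(* An odd-dimensional cosquare has eigenvalue 1, because g^T - g is singular. *)
Lemma cosquare_expr_central m (g : {'GL_(m.+1)[F]}) k (c := (invtr g * g)%g) :
  odd m.+1 -> (c ^+ k)%g \in 'Z('GL_(m.+1)[F])%g -> (c ^+ k)%g = 1%g.
Proof.
move=> m_odd cZ; have [a cka] := GL_center_scalar cZ.
apply: val_inj; rewrite -[val _]/(GLval _) cka.
pose C := (GLval c)^T; have CG : C *m GLval g = (GLval g)^T := cosquareE g.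
have /det0P[v v0 vC] : \det (C - 1) == 0.
  have /(alternating_odd_singular pF p_odd) :
      ((C - 1) *m GLval g)^T = - ((C - 1) *m GLval g).
    by rewrite mulmxBl mul1mx CG linearB /= trmxK opprB.
  move/(_ m_odd); rewrite unitmx_mul [GLval g \in _]GL_unit andbT.
  by rewrite unitmxE unitfE negbK.
(* A scalar power of [C] that fixes the nonzero vector [v] must be 1. *)
have vCk : v *m C ^+ k = v.
  elim: k {cZ cka} => [|k IH]; first by rewrite expr0 mulmx1.
  rewrite exprS -[_ * _]/(_ *m _) mulmxA.
  have -> : v *m C = v; last exact: IH.
  by apply/eqP; rewrite -subr_eq0 -{2}[v]mulmx1 -mulmxBr vC.
move: vCk; rewrite -trmx_exp -GL_expg cka tr_scalar_mx mul_mx_scalar => /eqP.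
rewrite -subr_eq0 -{2}[v]scale1r -scalerBl scaler_eq0 (negbTE v0) orbF.
by rewrite subr_eq0 => /eqP->.
Qed.
End GL.

(** * The coset of tau *)

Section Tau.
Local Open Scope group_scope.
Local Set Implicit Arguments.
Local Unset Strict Implicit.
Variables (F : finFieldType) (m p : nat).
Local Notation n := m.+2.
Local Notation G := {'GL_n[F]}.
Local Notation Z := 'Z('GL_n[F]).
Local Notation t := (sdpair2 (tau_act n F) (tau n F)).
Local Notation inj := (sdpair1 (tau_act n F)).

Lemma GL_norm_center (g : G) : g \in 'N(Z).
Proof. by apply: (subsetP (normal_norm (center_normal _))); rewrite inE. Qed.

Lemma coset_PGL (g : G) : coset Z g \in PGL n F.
Proof. by apply: mem_quotient; rewrite inE. Qed.

Lemma tau_coset_coset (X : {set coset_of Z}) x : X \subset PGL n F ->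
  reflect (exists2 g : G, coset Z g \in X & x = t * inj (coset Z g))
          (x \in tau_coset X).
Proof.
move=> sX; apply: (iffP lcosetP) => [[_ /morphimP[y _ Xy ->] ->]|[g Xg ->]].
  by exists (repr y); rewrite coset_reprK.
exists (inj (coset Z g)) => //; apply: mem_morphim => //.
exact: coset_PGL.
Qed.

Lemma tau_sqr : tau n F * tau n F = 1.
Proof.
by apply/permP => x; rewrite permM perm1 -[x]coset_reprK !tauE invtrK.
Qed.

Hypotheses (pF : p \in [pchar F]%R) (p_odd : odd p).

(** Otherwise [g^T g] would be scalar for every [g], but for a transvection it has a nonzero
    off-diagonal entry. *)
Lemma tau_neq1 : tau n F != 1.
Proof.
apply/eqP => tau1.
pose i1 : 'I_n := lift ord0 ord0.
have ij : (ord0 : 'I_n) != i1 by [].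
have [g gE] := GL_of_unitmx (transvection_unit pF ij).
have := tauE g; rewrite tau1 perm1 => /esym gZ.
have /GL_center_scalar-/(_ p pF)[a aE] : invtr g * g^-1 \in Z.
  apply: coset_idr; first exact: GL_norm_center.
  by rewrite morphM ?morphV ?GL_norm_center //= gZ mulgV.
have gu : GLval g \in unitmx := GL_unit g.
have gg : (a *: ((GLval g)^T *m GLval g) = 1%:M)%R.
  rewrite scalemxAl -mul_mx_scalar -aE GL_MxE GL_VxE invtrE.
  by rewrite !mulmxA -trmx_mul mulVmx // trmx1 mul1mx mulVmx.
have /matrixP/(_ ord0 i1) := gg.
have gT : ((GLval g)^T = 1 + delta_mx i1 ord0)%R.
  by rewrite gE [LHS]linearD /= trmx1 trmx_delta.
rewrite gT gE mulmxDl mul1mx mulmxDr mulmx1 mul_delta_mx.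
rewrite !mxE /= !(addr0, add0r) mulr1 => a0.
have /matrixP/(_ ord0 ord0) := gg.
by rewrite a0 scale0r !mxE /= => /eqP; rewrite eq_sym oner_eq0.
Qed.

Lemma tau_coset_sqr (g : G) :
  (t * inj (coset Z g)) ^+ 2 = inj (coset Z (invtr g * g)).
Proof.
have tt : t * t = 1 by rewrite -morphM ?cycle_id // tau_sqr morph1.
have tV : t^-1 = t by apply/eqP; rewrite eq_invg_mul tt.
have yt : inj (coset Z g) ^ t = inj (coset Z (invtr g)).
  by rewrite -sdpair_act ?cycle_id ?coset_PGL // -tauE.
rewrite !morphM ?GL_norm_center ?coset_PGL //= -yt conjgE tV !mulgA.
by rewrite expgS expg1 !mulgA.
Qed.

Lemma order_tau_coset (g : G) : odd n ->
  #[t * inj (coset Z g)] = (2 * #[(invtr g * g)%g])%N.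
Proof.
move=> n_odd; apply: order_eq_dvd => k; set x := t * _.
(* Even powers are images of powers of [invtr g * g], and such a power is central only if it is
   1. *)
have xx j : (x ^+ (2 * j) == 1) = (#[invtr g * g] %| j).
  rewrite expgM tau_coset_sqr -morphX ?coset_PGL // -morphX ?GL_norm_center //=.
  rewrite morph_injm_eq1 ?injm_sdpair1 ?coset_PGL //.
  rewrite order_dvdn; apply/eqP/eqP => [c1|->]; last exact: morph1.
  apply: (cosquare_expr_central pF p_odd n_odd).
  by apply: coset_idr; first exact: GL_norm_center.
have [k_odd|k_even] := boolP (odd k); last first.
  by rewrite -(even_halfK k_even) -mul2n xx dvdn_pmul2l.
rewrite [RHS](_ : _ = false); last first.
  apply: contraTF k_odd => /(dvdn_trans (dvdn_mulr _ (dvdnn 2))).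
  by rewrite dvdn2.
apply/negbTE; apply: contraNneq tau_neq1 => xk.
(* If an odd power of [x] were 1, then [t] would lie in the image of [PGL], which meets the
   complement trivially. *)
have xk' : inj (coset Z ((invtr g * g) ^+ k./2)) * (t * inj (coset Z g)) = 1.
  rewrite morphX ?GL_norm_center // morphX ?coset_PGL //= -tau_coset_sqr -expgM.
  by rewrite mul2n -expgSr -[RHS]xk -[X in _ = _ ^+ X]odd_double_half k_odd.
have : t \in inj @* PGL n F :&: sdpair2 (tau_act n F) @* <[tau n F]>.
  rewrite inE andbC mem_morphim ?cycle_id //=.
  rewrite -[t](mulgK (inj (coset Z g))).
  rewrite -[_ * inj _](mulKg (inj (coset Z ((invtr g * g) ^+ k./2)))).
  by rewrite xk' mulg1 -invMg groupV groupM // mem_morphim // coset_PGL.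
rewrite im_sdpair_TI => /set1gP/eqP.
by rewrite morph_injm_eq1 ?injm_sdpair2 ?cycle_id.
Qed.
End Tau.

(** * The standard symplectic form and the comparison of the sets of orders *)

Section Main.
Local Open Scope ring_scope.
Local Set Implicit Arguments.
Local Unset Strict Implicit.
Variable (F : finFieldType).

Lemma pchar_of_card p k : prime p -> #|F| = (p ^ k)%N -> p \in [pchar F].
Proof.
move=> p_pr cardF; have : (1 : F) *+ #|F| = 0.
  by rewrite -cardsT -FinRing.zmodXgE expg_cardG ?inE.
rewrite cardF natrX => /eqP; rewrite expf_eq0 => /andP[_ p0].
by rewrite inE p_pr.
Qed.

Lemma tr_expr_eq1 n (A : 'M[F]_n) k : (A^T ^+ k == 1) = (A ^+ k == 1).
Proof. by rewrite -trmx_exp -[X in _ == X]trmx1 (inj_eq trmx_inj). Qed.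

Lemma cosquare_unique m (g : {'GL_(m.+1)[F]}) (c : 'M[F]_m.+1) :
  c *m GLval g = (GLval g)^T -> c = (GLval (invtr g * g)%g)^T.
Proof.
move=> cg; have gu : GLval g \in unitmx := GL_unit g.
by apply: (can_inj (mulmxK gu)); rewrite cg cosquareE.
Qed.

(* For n = 2r + 1 and d = det g, the form d^-1 D g D^T with det D = d ^ r has
   determinant d ^ (2r + 1 - n) = 1 and a cosquare conjugate to that of g. *)
Lemma det1_same_cosquare_order m (g : {'GL_(m.+1)[F]}) : odd m.+1 ->
  exists2 g' : {'GL_(m.+1)[F]}, \det (GLval g') = 1 &
    #[invtr g' * g']%g = #[invtr g * g]%g.
Proof.
move=> m_odd; pose d := \det (GLval g).
have d0 : d != 0 := GL_det g.
pose D : 'M[F]_m.+1 := diag_mx (\row_j (if j == ord0 then d ^+ m./2 else 1)).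
have DE : \det D = d ^+ m./2.
  rewrite det_diag (bigD1 ord0) //= !mxE eqxx big1 ?mulr1 // => j /negbTE j0.
  by rewrite mxE j0.
have Du : D \in unitmx by rewrite unitmxE DE unitrX // unitfE.
pose B := d^-1 *: (D *m GLval g *m D^T).
have B1 : \det B = 1.
  rewrite detZ !det_mulmx det_tr DE -/d mulrAC -exprD addnn even_halfK //.
  by rewrite -exprSr exprVn mulVf // expf_neq0.
have [g' gE] : exists g' : {'GL_(m.+1)[F]}, GLval g' = B.
  by apply: GL_of_unitmx; rewrite unitmxE B1 unitr1.
exists g'; rewrite ?gE //; apply: eq_GL_order => k.
rewrite -tr_expr_eq1 -[RHS]tr_expr_eq1 -[RHS](conj_expr_eq1 _ _ Du).
rewrite -(@cosquare_unique _ g' (D *m (GLval (invtr g * g)%g)^T *m invmx D)) //.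
rewrite gE -scalemxAr !mulmxA mulmxKV // -(mulmxA D) cosquareE.
by rewrite linearZ /= !trmx_mul trmxK mulmxA.
Qed.

Lemma Sp_form_alternating m : (Sp_form m.+1 F)^T = - Sp_form m.+1 F.
Proof. by apply/matrixP => i j; rewrite !mxE opprB. Qed.

Lemma Sp_form_unit m : odd m -> Sp_form m.+1 F \in unitmx.
Proof.
move=> m_odd; set h := (m.+1./2)%N.
have hE : (h + h = m.+1)%N.
  by rewrite addnn even_halfK //= m_odd.
(* [s] exchanges the two halves of the indices; [Sp_form] is its permutation matrix with signs [e],
   hence orthogonal. *)
pose s (i : nat) := (if i < h then i + h else i - h)%N.
have sm i : (i < m.+1 -> s i < m.+1)%N.
  move=> im; rewrite /s; case: (ltnP i h) => ih; last first.
    by rewrite (leq_ltn_trans (leq_subr _ _)).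
  by rewrite -hE ltn_add2r.
have sI (i j : nat) : s i = s j -> (i < m.+1)%N -> (j < m.+1)%N -> i = j.
  rewrite /s -hE; case: (ltnP i h) => ih; case: (ltnP j h) => jh E im jm.
  - exact: addIn E.
  - by move: jm; rewrite -(subnK jh) -E ltn_add2r ltnNge leq_addl.
  - by move: im; rewrite -(subnK ih) E ltn_add2r ltnNge leq_addl.
  - by rewrite -(subnK ih) E subnK.
pose e (i : nat) : F := if (i < h)%N then 1 else -1.
have JE (i j : 'I_m.+1) : Sp_form m.+1 F i j = e i * (j == s i :> nat)%:R.
  rewrite mxE -/h /e /s; case: ltnP => ih.
    rewrite mul1r (_ : (i == j + h :> nat)%N = false) ?subr0 //.
    by rewrite ltn_eqF // ltn_addl.
  rewrite mulN1r (_ : (j == i + h :> nat)%N = false) ?sub0r.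
    by rewrite -(eqn_add2r h j) subnK // eq_sym.
  rewrite ltn_eqF // (leq_trans (ltn_ord j)) //.
  by rewrite (leq_trans (eq_leq (esym hE))) // leq_add2r.
have /mulmx1_unit[] // : Sp_form m.+1 F *m (Sp_form m.+1 F)^T = 1%:M.
apply/matrixP => i j; rewrite !mxE.
rewrite (bigD1 (Ordinal (sm i (ltn_ord i)))) //= big1 => [|k ki]; last first.
  rewrite JE (_ : (k == _ :> nat) = false) ?mulr0 ?mul0r //.
  by apply: contraNF ki => /eqP ki; apply/eqP/val_inj.
rewrite addr0 [in X in _ * X]mxE !JE /= eqxx mulr1 mulrCA.
have -> : (s i == s j) = (i == j).
  by apply/eqP/eqP => [/sI E|-> //]; apply/val_inj/E.
have [->|] := eqVneq i j; last by rewrite !mulr0.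
by rewrite mulr1 /e; case: ifP; rewrite ?mulr1 // mulrNN mulr1.
Qed.
End Main.

Theorem lemma4p6 (p k q n : nat) (F : finFieldType)
    (p_prime : prime p) (p_odd : odd p) (k_gt0 : 0 < k) (qE : q = p ^ k)
    (cardF : #|F| = q) (n_ge3 : 3 <= n) (n_odd : odd n) :
  omega (tau_coset (PSL n F)) = omega (tau_coset (PGL n F)) /\
  omega (tau_coset (PGL n F)) = [fset 2 * a | a in omega (Sp n.-1 F)]%fset.
Proof.
have pF : p \in [pchar F]%R :=
  pchar_of_card p_prime (etrans cardF qE).
case: n n_ge3 n_odd => [|[|[|m]]] // _ n_odd.
have sPSL : PSL m.+3 F \subset PGL m.+3 F by apply: quotientS; apply: subsetT.
have sPGL := subxx (PGL m.+3 F).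
have Ju := @Sp_form_unit F m.+1 (negbNE n_odd).
have JT := @Sp_form_alternating F m.+1.
pose t := sdpair2 (tau_act m.+3 F) (tau m.+3 F).
pose inj := sdpair1 (tau_act m.+3 F).
split; apply/fsetP => x; apply/imfsetP/imfsetP.
- case=> y /= /(tau_coset_coset _ sPSL)[g gP ->] ->.
  exists (t * inj (coset _ g))%g => //=.
  by apply/(tau_coset_coset _ sPGL); exists g => //; apply: (subsetP sPSL).
- case=> y /= /(tau_coset_coset _ sPGL)[g _ ->] ->.
  (* Scaling and congruence bring the determinant to 1 without changing the order of the
     cosquare. *)
  have [g' g'1 g'o] := det1_same_cosquare_order g n_odd.
  exists (t * inj (coset _ g'))%g => /=.
    apply/(tau_coset_coset _ sPSL); exists g' => //.
    by apply: mem_morphim; rewrite ?GL_norm_center // inE g'1.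
  by rewrite !(order_tau_coset pF p_odd) // g'o.
- case=> y /= /(tau_coset_coset _ sPGL)[g _ ->] ->.
  rewrite (order_tau_coset pF p_odd) //.
  have [A [s [Au AT sA sE]]] :=
    isometry_of_cosquare pF p_odd n_odd (GL_unit g) (cosquareE g).
  have [P Pu PA] := alternating_congruent pF p_odd Au AT Ju JT.
  (* The isometry [s] is moved to [Sp_form] by [P], then transposed because [Sp] is defined by
     [g^T J g = J], while [s] follows the row convention. *)
  have [h hE] : exists h : {'GL_(m.+2)[F]}, GLval h = ((P *m s *m invmx P)^T)%R.
    apply: GL_of_unitmx; rewrite unitmx_tr !unitmx_mul Pu unitmx_inv Pu andbT.
    by move: Au; rewrite -{1}sA !unitmx_mul => /andP[/andP[->]].
  exists #[h]%g; last congr (2 * _).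
    apply/imfsetP; exists h => //=; rewrite inE hE trmxK -PA; apply/eqP.
    rewrite !trmx_mul !mulmxA mulmxKV // -(mulmxA _ P^T) -trmx_mul mulVmx //.
    by rewrite trmx1 mulmx1 -(mulmxA P s) -(mulmxA P (s *m A)) sA.
  apply: eq_GL_order => j.
  by rewrite hE tr_expr_eq1 conj_expr_eq1 // sE tr_expr_eq1.
- case=> _ /= /imfsetP[h /= + ->] ->; rewrite inE => /eqP hJ.
  have sJ : ((GLval h)^T *m Sp_form m.+2 F *m (GLval h)^T^T = Sp_form m.+2 F)%R.
    by rewrite trmxK.
  have [g0 [c [g0u cg cE]]] := cosquare_of_isometry pF p_odd Ju JT sJ.
  have [g gE] := GL_of_unitmx g0u.
  have cC : c = ((GLval (invtr g * g)%g)^T)%R.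
    by apply: cosquare_unique; rewrite gE.
  exists (t * inj (coset _ g))%g => /=.
    by apply/(tau_coset_coset _ sPGL); exists g => //; apply: coset_PGL.
  rewrite (order_tau_coset pF p_odd) //; congr (2 * _).
  by apply: eq_GL_order => j; rewrite -tr_expr_eq1 -cE cC tr_expr_eq1.
Qed.
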